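(* Let $m\ge 2$, $t\ge 1$, $v=mt$, and let $\mathcal{F}=\{\Pi_\alpha:\alpha\in\mathcal{A}\}$ be a family of distinct $\mathbb{Z}_v$-regular embeddings of $K_{m\times t}$. If $\Pi_0$ is a $\mathbb{Z}_v$-regular embedding of $K_{m\times t}$ such that $\Pi_\alpha$ is isomorphic to $\Pi_0$ for every $\alpha\in\mathcal{A}$, then $$|\mathcal{F}|\le 2|Aut_0(\Pi_0)|\cdot|N(K_{m\times t},0)|\le 4|N(K_{m\times t},0)|^2=4((m-1)t)^2 .$$ Moreover, if for every $\alpha\in\mathcal{A}$ and every $g\in\mathbb{Z}_v$ the translation $\tau_g$ belongs to $Aut^+(\Pi_\alpha)$, then $$|\mathcal{F}|\le 2|Aut_0^+(\Pi_0)|\cdot|N(K_{m\times t},0)|\le 2|N(K_{m\times t},0)|^2=2((m-1)t)^2 .$$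
   Context: $K_{m\times t}$ is the complete multipartite graph with $m$ parts of size $t$. For a graph $\Gamma$, $D(\Gamma)$ is the set of oriented edges $(x,y)$ and $N(\Gamma,x)$ the neighbourhood of the vertex $x$. A (combinatorial) embedding of a connected graph $\Gamma$ into an orientable surface is a pair $\Pi=(\Gamma,\rho)$ with $\rho:D(\Gamma)\to D(\Gamma)$ such that, for each vertex $x$, $\rho(x,y)=(x,\rho_x(y))$ for $y\in N(\Gamma,x)$, where $\rho_x$ is a cyclic permutation of $N(\Gamma,x)$ of order $|N(\Gamma,x)|$. Two embeddings are equal if they are equal as pairs $(\Gamma,\rho)$; otherwise they are distinct. An embedding isomorphism from $(\Gamma,\rho)$ to $(\Gamma',\rho')$ is a graph isomorphism $\sigma:\Gamma\to\Gamma'$ such that either $\sigma\circ\rho=\rho'\circ\sigma$ on all of $D(\Gamma)$ (orientation preserving) or $\sigma\circ\rho=(\rho')^{-1}\circ\sigma$ on all of $D(\Gamma)$ (orientation reversing), where $\sigma(x,y)=(\sigma(x),\sigma(y))$. $Aut(\Pi)$ is the group of all embedding automorphisms of $\Pi$, $Aut^+(\Pi)$ the subgroup of orientation preserving ones, and $Aut_0(\Pi)$, $Aut_0^+(\Pi)$ their subgroups fixing the vertex $0$. A $\mathbb{Z}_v$-regular embedding is one admitting $\mathbb{Z}_v$ as a group of automorphisms acting regularly on vertices; by convention its vertex set is identified with $\mathbb{Z}_v$ so that the translations $\tau_g:x\mapsto x+g$ belong to $Aut(\Pi)$ for all $g\in\mathbb{Z}_v$. *)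

(* Defs.v *)
From HB Require Import structures.
From mathcomp Require Import all_boot all_order all_algebra all_fingroup.

Set Implicit Arguments.
Unset Strict Implicit.
Unset Printing Implicit Defensive.

Local Open Scope nat_scope.

(* A finite simple graph on T is given by its set of oriented edges. *)
Definition simple_darts (T : finType) (D : {set T * T}) : bool :=
  [forall x, forall y, ((x, y) \in D) == ((y, x) \in D)]
  && [forall x, (x, x) \notin D].

Record sgraph (T : finType) := SGraph {
  darts : {set T * T};
  dartsP : simple_darts darts
}.

HB.instance Definition _ (T : finType) := [isSub for @darts T].
HB.instance Definition _ (T : finType) := [Finite of sgraph T by <:].

Definition adj (T : finType) (G : sgraph T) : rel T :=
  fun x y => (x, y) \in darts G.

Definition nbh (T : finType) (G : sgraph T) (x : T) : {set T} :=
  [set y | adj G x y].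

Definition connected (T : finType) (G : sgraph T) : bool :=
  [forall x, forall y, connect (adj G) x y].

Definition graph_iso (T T' : finType) (G : sgraph T) (G' : sgraph T')
    (f : T -> T') : bool :=
  [&& injectiveb f, [forall y, y \in codom f] &
      [forall x, forall y, adj G' (f x) (f y) == adj G x y]].

Fact multipartite_darts (m t : nat) :
  simple_darts [set d : ('I_m * 'I_t) * ('I_m * 'I_t) | d.1.1 != d.2.1].
Proof.
apply/andP; split; last by apply/forallP => x; rewrite inE eqxx.
by apply/forallP => x; apply/forallP => y; rewrite !inE [y.1 == _]eq_sym.
Qed.

Definition complete_multipartite (m t : nat) : sgraph ('I_m * 'I_t)%type :=
  SGraph (multipartite_darts m t).

(* s is a cyclic permutation of A of order #|A|; it is extended by the
   identity outside A. *)
Definition cyclic_perm_on (T : finType) (A : {set T}) (s : {perm T}) : bool :=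
  perm_on A s && [forall y in A, porbit s y == A].

(* The permutation rho of D(G) is represented by its extension by the identity
   to T * T, so that equality of pairs (G, rho) is equality of embeddings. *)
Definition is_embedding (T : finType) (P : sgraph T * {perm T * T}) : bool :=
  let: (G, rho) := P in
  [&& connected G, perm_on (darts G) rho &
      [forall x, exists rho_x : {perm T}, cyclic_perm_on (nbh G x) rho_x &&
        [forall y in nbh G x, rho (x, y) == (x, rho_x y)]]].

Record embedding (T : finType) := Embedding {
  emb_pair : sgraph T * {perm T * T};
  emb_pairP : is_embedding emb_pair
}.

HB.instance Definition _ (T : finType) := [isSub for @emb_pair T].
HB.instance Definition _ (T : finType) := [Finite of embedding T by <:].

Definition emb_graph (T : finType) (P : embedding T) : sgraph T :=
  (emb_pair P).1.
Definition emb_rot (T : finType) (P : embedding T) : {perm T * T} :=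
  (emb_pair P).2.

Definition dart_map (T T' : finType) (f : T -> T') (d : T * T) : T' * T' :=
  (f d.1, f d.2).

Definition preserving (T T' : finType) (P : embedding T) (P' : embedding T')
    (f : T -> T') : bool :=
  [forall d in darts (emb_graph P),
     dart_map f (emb_rot P d) == emb_rot P' (dart_map f d)].

Definition reversing (T T' : finType) (P : embedding T) (P' : embedding T')
    (f : T -> T') : bool :=
  [forall d in darts (emb_graph P),
     dart_map f (emb_rot P d) == ((emb_rot P')^-1)%g (dart_map f d)].

Definition emb_iso (T T' : finType) (P : embedding T) (P' : embedding T')
    (f : T -> T') : bool :=
  graph_iso (emb_graph P) (emb_graph P') f
  && (preserving P P' f || reversing P P' f).

Definition isomorphic (T T' : finType) (P : embedding T) (P' : embedding T') :
  Prop := exists f : T -> T', emb_iso P P' f.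

Definition Aut_emb (T : finType) (P : embedding T) : {set {perm T}} :=
  [set s : {perm T} | emb_iso P P s].

Definition Aut_emb_plus (T : finType) (P : embedding T) : {set {perm T}} :=
  [set s in Aut_emb P | preserving P P s].

Definition fixing (T : finType) (x : T) (A : {set {perm T}}) : {set {perm T}} :=
  [set s in A | s x == x].

Definition Aut0 (v : nat) (P : embedding 'Z_v) : {set {perm 'Z_v}} :=
  fixing 0%R (Aut_emb P).

Definition Aut0_plus (v : nat) (P : embedding 'Z_v) : {set {perm 'Z_v}} :=
  fixing 0%R (Aut_emb_plus P).

Definition translation (v : nat) (g : 'Z_v) : {perm 'Z_v} :=
  perm (@GRing.addIr _ g).

(* The graph is any copy of K_{m x t} on Z_v: the identification of the vertex
   set with Z_v is attached to the embedding, not fixed in advance. *)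
Definition Z_regular_embedding (v m t : nat) (P : embedding 'Z_v) : Prop :=
  (exists f : 'Z_v -> 'I_m * 'I_t,
     graph_iso (emb_graph P) (complete_multipartite m t) f)
  /\ forall g : 'Z_v, translation g \in Aut_emb P.

(* Main.v *)
Require Import Defs.
From HB Require Import structures.
From mathcomp Require Import all_boot all_order all_algebra all_fingroup.

(** Composing an isomorphism [P -> P0] with a translation of [P], one may
    choose for each [P] in the family an isomorphism [s] with [s 0 = 0].
    Conjugating the unit translation [x |-> x + 1] by [s] gives an automorphism
    [c] of [P0], and [s k] is the image of [0] under the [k]-th power of [c],
    so [c] determines [s]. As the rotation of [P0] is the transport along [s]
    of the rotation of [P] or of its inverse, [P] is determined by [c] and one
    sign ([card_isomorphic_family]). Moreover [c] sends [0] to [s 1], which is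
    a neighbour of [0]: [0] and [1] are adjacent in [P], for otherwise
    translation invariance would make all vertices pairwise nonadjacent
    ([Z_regular_adj01]). For each neighbour [y] of [0], the automorphisms
    sending [0] to [y] form at most one coset of the stabiliser of [0]
    ([card_moving_into]), whence the first inequality. When the translations
    preserve the orientation of [P], so does [c] on [P0], whether or not [s]
    does, and the same count is made in the orientation preserving group.

    The second inequality is rigidity: two isomorphisms that treat the
    orientation in the same way and agree on one dart are equal
    ([signed_iso_rigid]), so at most as many automorphisms of each kind fix
    [0] as there are neighbours of [0].

    A vertex permutation [s] acts on all pairs of vertices by [dart_perm s].
    The condition on rotations then becomes a conjugacy relation between
    permutations of pairs, and isomorphisms compose and invert by group
    computations. *)

Set Implicit Arguments.
Unset Strict Implicit.
Unset Printing Implicit Defensive.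

Import GRing.Theory.

Local Open Scope nat_scope.

(** * Permutations of vertices acting on pairs of vertices *)

Section DartPerm.

Variable T : finType.
Implicit Types s u : {perm T}.

Lemma dart_map_inj s : injective (dart_map s).
Proof.
by move=> [a b] [c d] [/perm_inj-> /perm_inj->].
Qed.

(** The action of a vertex permutation on ordered pairs of vertices. *)
Definition dart_perm s : {perm T * T} := perm (@dart_map_inj s).

Lemma dart_permE s d : dart_perm s d = (s d.1, s d.2).
Proof. by rewrite permE. Qed.

Lemma dart_perm1 : dart_perm 1 = 1%g.
Proof. by apply/permP => -[x y]; rewrite dart_permE !perm1. Qed.

Lemma dart_permM s u : dart_perm (s * u) = (dart_perm s * dart_perm u)%g.
Proof. by apply/permP => d; rewrite permM !dart_permE !permM. Qed.

Lemma dart_permV s : dart_perm s^-1 = ((dart_perm s)^-1)%g.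
Proof.
by apply/esym/eqP; rewrite eq_invg_mul -dart_permM mulgV dart_perm1.
Qed.

End DartPerm.

(** * Isomorphisms with a prescribed behaviour on orientation *)

Section SignedIso.

Variable T : finType.
Implicit Types (P Q R : embedding T) (s u : {perm T}) (b : bool).

(** The rotation of [P], inverted when [b] is true. *)
Definition signed_rot b P : {perm T * T} :=
  if b then ((emb_rot P)^-1)%g else emb_rot P.

(** [s] is an isomorphism from [P] to [Q], orientation preserving when [b] is
    false and orientation reversing when [b] is true. Since rotations are
    the identity off the darts, the condition on rotations is a conjugacy
    of permutations of all pairs. *)
Definition signed_iso b P Q s : bool :=
  [forall d, (dart_perm s d \in darts (emb_graph Q))
             == (d \in darts (emb_graph P))]
  && (emb_rot P ^ dart_perm s == signed_rot b Q)%g.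

Lemma signed_isoP b P Q s :
  reflect ((forall d, (dart_perm s d \in darts (emb_graph Q))
                      = (d \in darts (emb_graph P)))
           /\ (emb_rot P ^ dart_perm s)%g = signed_rot b Q)
          (signed_iso b P Q s).
Proof.
apply: (iffP andP) => -[hD hr]; split.
- by move=> d; apply/eqP/(forallP hD).
- exact/eqP.
- by apply/forallP => d; apply/eqP.
- exact/eqP.
Qed.

Lemma signed_rotJ b P (r : {perm T * T}) :
  (signed_rot b P ^ r)%g
  = if b then ((emb_rot P ^ r)^-1)%g else (emb_rot P ^ r)%g.
Proof. by case: b => //=; rewrite conjVg. Qed.

Lemma signed_iso1 P : signed_iso false P P 1.
Proof. by apply/signed_isoP; rewrite dart_perm1 conjg1; split=> // d; rewrite perm1. Qed.

Lemma signed_isoM b c P Q R s u :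
  signed_iso b P Q s -> signed_iso c Q R u ->
  signed_iso (b (+) c) P R (s * u)%g.
Proof.
move=> /signed_isoP[hD hr] /signed_isoP[hD' hr']; apply/signed_isoP.
rewrite dart_permM; split; first by move=> d; rewrite permM hD' hD.
by rewrite conjgM hr signed_rotJ hr'; case: (b); case: (c); rewrite //= invgK.
Qed.

Lemma signed_isoV b P Q s : signed_iso b P Q s -> signed_iso b Q P s^-1%g.
Proof.
move=> /signed_isoP[hD hr]; apply/signed_isoP; rewrite dart_permV; split.
  by move=> d; rewrite -hD permKV.
apply: (canLR (conjgK _)); case: b hr => /= hr; last exact: esym.
by rewrite conjVg hr invgK.
Qed.

(** An embedding is recovered from any isomorphism to a known embedding
    together with its sign. *)
Lemma signed_iso_inj b P Q R s :
  signed_iso b P R s -> signed_iso b Q R s -> P = Q.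
Proof.
move=> /signed_isoP[hD hr] /signed_isoP[hD' hr'].
apply: val_inj; rewrite /= [emb_pair P]surjective_pairing.
rewrite [emb_pair Q]surjective_pairing; congr pair.
  by apply: val_inj; apply/setP => d; rewrite -[LHS]hD hD'.
by apply: (@conjg_inj _ (dart_perm s)); rewrite [LHS]hr -hr'.
Qed.

Lemma emb_rot_out P d : d \notin darts (emb_graph P) -> emb_rot P d = d.
Proof.
by case: P => -[G r] hP; have /and3P[_ hr _] := hP; exact: out_perm hr.
Qed.

Lemma signed_rot_out b P d :
  d \notin darts (emb_graph P) -> signed_rot b P d = d.
Proof.
move=> hd; case: b => /=; last exact: emb_rot_out.
by apply: (canLR (permK _)); rewrite emb_rot_out.
Qed.

(** The conjugacy of rotations on all pairs amounts to the intertwining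
    condition on the darts alone, both rotations being the identity elsewhere. *)
Lemma signed_isoE b P Q s :
  signed_iso b P Q s =
  graph_iso (emb_graph P) (emb_graph Q) s &&
  [forall d in darts (emb_graph P),
     dart_map s (emb_rot P d) == signed_rot b Q (dart_map s d)].
Proof.
apply/signed_isoP/andP => -[].
  move=> hD hr; split.
    apply/and3P; split.
    - exact/injectiveP/perm_inj.
    - by apply/forallP => y; apply/codomP; exists (s^-1 y)%g; rewrite permKV.
    - apply/forallP => x; apply/forallP => y; apply/eqP.
      by have := hD (x, y); rewrite dart_permE.
  apply/forall_inP => d _; apply/eqP.
  by have := permJ (emb_rot P) (dart_perm s) d; rewrite hr !permE.
move=> /and3P[_ _ /forallP hD] /forall_inP hr.
have hD' d : (dart_perm s d \in darts (emb_graph Q)) = (d \in darts (emb_graph P)).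
  by case: d => x y; rewrite dart_permE; exact/eqP/(forallP (hD x)).
split=> //; apply/permP => d.
have [e ->] : exists e, d = dart_perm s e.
  by exists ((dart_perm s)^-1%g d); rewrite permKV.
rewrite permJ.
case: (boolP (e \in darts (emb_graph P))) => he.
  by have /eqP := hr e he; rewrite ![dart_perm s _]permE.
by rewrite emb_rot_out // signed_rot_out // hD'.
Qed.

Lemma emb_isoE P Q s :
  emb_iso P Q s = signed_iso false P Q s || signed_iso true P Q s.
Proof. by rewrite /emb_iso !signed_isoE -andb_orr. Qed.

Lemma emb_isoP P Q s : reflect (exists b, signed_iso b P Q s) (emb_iso P Q s).
Proof.
rewrite emb_isoE; apply: (iffP orP) => [[] h|[[] h]];
  by [exists false | exists true | right | left].
Qed.

Lemma isomorphic_perm P Q :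
  isomorphic P Q -> exists b s, signed_iso b P Q s.
Proof.
case=> f hf; have /andP[/and3P[/injectiveP hi _ _] _] := hf.
have /emb_isoP[b hb] : emb_iso P Q (perm hi).
  have e : perm hi =1 f by move=> x; rewrite permE.
  have ed d : dart_map (perm hi) d = dart_map f d by rewrite /dart_map !e.
  have [/and3P[_ /forallP h2 /forallP h3] h4] := andP hf.
  apply/andP; split.
    apply/and3P; split.
    - exact/injectiveP/perm_inj.
    - apply/forallP => y; have := h2 y.
      by rewrite (eq_codom e).
    - by apply/forallP => x; apply/forallP => y; rewrite !e; exact: (forallP (h3 x)).
  move: h4; rewrite /preserving /reversing.
  by under eq_forallb => d do rewrite -!ed;
     under [X in _ || X]eq_forallb => d do rewrite -!ed.
by exists b, (perm hi).
Qed.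

Lemma Aut_embP P s :
  reflect (exists b, signed_iso b P P s) (s \in Aut_emb P).
Proof. by rewrite inE; exact: emb_isoP. Qed.

Lemma Aut_emb_plusE P s : (s \in Aut_emb_plus P) = signed_iso false P P s.
Proof.
rewrite inE inE signed_isoE /emb_iso /preserving /=.
by case: graph_iso => //=; apply/andb_idl => ->.
Qed.

Lemma Aut_emb_group_set P : group_set (Aut_emb P).
Proof.
apply/group_setP; split; first by apply/Aut_embP; exists false; exact: signed_iso1.
move=> s u /Aut_embP[b hb] /Aut_embP[c hc].
by apply/Aut_embP; exists (b (+) c); exact: signed_isoM hb hc.
Qed.

Lemma Aut_emb_plus_group_set P : group_set (Aut_emb_plus P).
Proof.
apply/group_setP; split; first by rewrite Aut_emb_plusE signed_iso1.
by move=> s u; rewrite !Aut_emb_plusE => hs hu; exact: signed_isoM hs hu.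
Qed.

End SignedIso.

(** * Rigidity *)

Section Rigidity.

Variable T : finType.
Implicit Types (P Q : embedding T) (s u : {perm T}) (b : bool).

Lemma adj_sym (G : sgraph T) : symmetric (adj G).
Proof.
move=> x y; have /andP[/forallP/(_ x)/forallP/(_ y)/eqP h _] := dartsP G.
exact: h.
Qed.

(** The rotation at [x] is transitive on the darts leaving [x]. *)
Lemma rot_transitive P x y z :
  adj (emb_graph P) x y -> adj (emb_graph P) x z ->
  exists n, (x, z) = ((emb_rot P) ^+ n)%g (x, y).
Proof.
case: P => -[G r] hP; have /and3P[_ _ /forallP/(_ x)/existsP[rx]] := hP.
rewrite /emb_graph /emb_rot /= => /andP[/andP[_ /forall_inP hc] /forall_inP hr] hy hz.
have {}hc y' : y' \in nbh G x -> porbit rx y' = nbh G x by move=> /hc/eqP.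
have hy' : y \in nbh G x by rewrite inE.
have /porbitP[n ->] : z \in porbit rx y by rewrite hc // inE.
exists n; elim: n => [|n IHn]; first by rewrite !expg0 !perm1.
rewrite !expgSr !permM -IHn; apply/esym/eqP/hr.
by rewrite -(hc y) // mem_porbit.
Qed.

Lemma signed_iso_rotX b P Q s n d :
  signed_iso b P Q s ->
  dart_perm s ((emb_rot P ^+ n)%g d) = (signed_rot b Q ^+ n)%g (dart_perm s d).
Proof. by move=> /signed_isoP[_ hr]; rewrite -permJ conjXg hr. Qed.

(** Two isomorphisms of the same sign that agree on a dart are equal: agreement
    spreads from a dart to all darts leaving the same vertex, and then along
    the edges of the connected graph. *)
Lemma signed_iso_rigid b P Q s u x y :
  signed_iso b P Q s -> signed_iso b P Q u ->
  adj (emb_graph P) x y -> s x = u x -> s y = u y -> s = u.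
Proof.
move=> hs hu.
have star x' y' z : adj (emb_graph P) x' y' -> s x' = u x' -> s y' = u y' ->
    adj (emb_graph P) x' z -> s z = u z.
  move=> hy ex ey hz; have [n en] := rot_transitive hy hz.
  suff: dart_perm s (x', z) = dart_perm u (x', z) by rewrite !dart_permE => -[].
  by rewrite en (signed_iso_rotX _ _ hs) (signed_iso_rotX _ _ hu) !dart_permE /= ex ey.
move=> hxy ex ey; apply/permP => z.
have /connectP[p hp ->] : connect (adj (emb_graph P)) x z.
  case: P {hs hu star hxy} => -[G r] hP.
  have /and3P[/forallP/(_ x)/forallP hc _ _] := hP.
  exact: hc.
elim: p x y hxy ex ey hp => [|w p IHp] x' y' hxy ex ey //= /andP[hw hp].
have ew : s w = u w by exact: star hxy ex ey hw.
by apply: (IHp w x') => //; rewrite adj_sym.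
Qed.

(** Isomorphisms of a given sign that fix [x] are determined by the image of
    one neighbour of [x], which is again a neighbour of [x]. *)
Lemma card_signed_iso_fixing b P x :
  0 < #|nbh (emb_graph P) x| ->
  #|[set s | signed_iso b P P s & s x == x]| <= #|nbh (emb_graph P) x|.
Proof.
case/card_gt0P => y; rewrite inE => hy.
rewrite -(@card_in_imset _ _ (fun s : {perm T} => s y)).
  apply/subset_leq_card/subsetP => _ /imsetP[s /[!inE]/andP[hs /eqP ex] ->].
  have /signed_isoP[hD _] := hs.
  by have := hD (x, y); rewrite dart_permE /= ex (hy : (x, y) \in darts _).
move=> s u /[!inE]/andP[hs /eqP ex] /andP[hu /eqP ex'] e.
by apply: (signed_iso_rigid hs hu hy) => //; rewrite ex ex'.
Qed.

Lemma card_Aut_emb_plus_fixing P x :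
  0 < #|nbh (emb_graph P) x| ->
  #|fixing x (Aut_emb_plus P)| <= #|nbh (emb_graph P) x|.
Proof.
move=> h; apply: leq_trans (card_signed_iso_fixing false h).
by apply/subset_leq_card/subsetP => s; rewrite !inE -Aut_emb_plusE !inE.
Qed.

Lemma card_Aut_emb_fixing P x :
  0 < #|nbh (emb_graph P) x| ->
  #|fixing x (Aut_emb P)| <= 2 * #|nbh (emb_graph P) x|.
Proof.
move=> h; rewrite mul2n -addnn.
apply: leq_trans (leq_add (card_signed_iso_fixing false h)
                          (card_signed_iso_fixing true h)).
apply: leq_trans (leq_card_setU _ _).
apply/subset_leq_card/subsetP => s; rewrite !inE emb_isoE.
by rewrite andb_orl.
Qed.

End Rigidity.

(** * Counting in permutation groups *)

(** In a permutation group, the elements sending [x] to a given point form at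
    most one coset of the stabiliser of [x]. *)
Lemma card_moving_into (T : finType) (G : {group {perm T}}) (x : T) (S : {set T}) :
  #|[set s in G | s x \in S]| <= #|fixing x G| * #|S|.
Proof.
rewrite -sum1_card mulnC -sum_nat_const.
rewrite (partition_big (fun s : {perm T} => s x) (mem S)) /=; last first.
  by move=> s /[!inE]/andP[].
apply: leq_sum => y _; rewrite sum1_card.
set A := (X in #|X|).
case: (pickP A) => [s0|A0]; last by rewrite (eq_card0 A0).
move=> /andP[/[!inE]/andP[Gs0 _] /eqP e0].
rewrite -(card_imset A (mulIg s0^-1%g)).
apply/subset_leq_card/subsetP => _ /imsetP[s /andP[/[!inE]/andP[Gs _] /eqP e] ->].
by rewrite groupM ?groupV //= permM e -e0 permK.
Qed.

(** * Translation-invariant embeddings *)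

Section Translations.

Variable v : nat.
Implicit Types (P Q : embedding 'Z_v) (s u : {perm 'Z_v}) (b : bool).

Lemma translationE (g x : 'Z_v) : translation g x = (x + g)%R.
Proof. by rewrite permE. Qed.

Lemma translation1X n : (translation (1%R : 'Z_v) ^+ n)%g 0%R = (n%:R)%R.
Proof.
elim: n => [|n IHn]; first by rewrite expg0 perm1.
by rewrite expgSr permM IHn translationE -natr1.
Qed.

(** A vertex permutation fixing [0] is determined by the conjugate it makes of
    the unit translation, because this translation is transitive. *)
Lemma conj_translation_inj s u :
  s 0%R = 0%R -> u 0%R = 0%R ->
  (translation (1%R : 'Z_v) ^ s = translation 1%R ^ u)%g -> s = u.
Proof.
have orbit0 (w : {perm 'Z_v}) (x : 'Z_v) : w 0%R = 0%R ->
    w x = ((translation 1%R ^ w) ^+ x)%g 0%R.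
  by move=> w0; rewrite -conjXg -[X in _ = _ X]w0 permJ translation1X natr_Zp.
by move=> s0 u0 e; apply/permP => x; rewrite (orbit0 s) // (orbit0 u) // e.
Qed.

(** Were [0] and [1] nonadjacent, translation invariance would put all
    vertices into the part of [0]. *)
Lemma Z_regular_adj01 (m t : nat) P :
  2 <= m -> 1 <= t -> Z_regular_embedding m t P -> adj (emb_graph P) 0%R 1%R.
Proof.
move=> hm ht [[f /and3P[_ /forallP hsurj hadj]] htr].
have {}hadj x y : adj (emb_graph P) x y = ((f x).1 != (f y).1).
  have /forallP/(_ x)/forallP/(_ y)/eqP <- := hadj.
  by rewrite /adj inE.
have [//|h01] := boolP (adj _ _ _).
have same (x : 'Z_v) : (f x).1 = (f 0%R).1.
  rewrite -[x]natr_Zp; elim: (nat_of_ord x) => [|n <-] //.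
  have /Aut_embP[b /signed_isoP[/(_ (0, 1)%R) + _]] := htr n%:R%R.
  rewrite dart_permE /= !translationE add0r [(1 + _)%R]addrC natr1.
  rewrite -![_ \in _]/(adj _ _ _) (negPf h01) hadj => /negbFE/eqP e.
  exact: esym.
have part i : i = (f 0%R).1.
  have /codomP[x e] := hsurj (i, Ordinal ht).
  by rewrite -(same x) -e.
by have := part (Ordinal (ltnW hm)); rewrite -(part (Ordinal hm)).
Qed.

(** Isomorphisms out of a translation-invariant embedding can be chosen to
    fix [0]. *)
Lemma isomorphic_fixing0 P Q :
  (forall g : 'Z_v, translation g \in Aut_emb P) -> isomorphic P Q ->
  exists b s, signed_iso b P Q s /\ s 0%R = 0%R.
Proof.
move=> htr /isomorphic_perm[b [s hs]].
have /Aut_embP[c hc] := htr (s^-1%g 0%R).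
exists (c (+) b), (translation (s^-1%g 0%R) * s)%g; split.
  exact: signed_isoM hc hs.
by rewrite permM translationE add0r permKV.
Qed.

(** An embedding [P] of the family is recovered from the sign of an isomorphism
    [s] from [P] to [P0] fixing [0], together with the automorphism of [P0]
    that is the conjugate by [s] of the unit translation. That automorphism
    moves [0] to a neighbour of [0]. *)
Lemma card_isomorphic_family (F : {set embedding 'Z_v}) (P0 : embedding 'Z_v)
    (G : {group {perm 'Z_v}}) :
  (forall P, P \in F -> adj (emb_graph P) 0%R 1%R) ->
  (forall P, P \in F -> forall g : 'Z_v, translation g \in Aut_emb P) ->
  (forall P, P \in F -> isomorphic P P0) ->
  (forall P b s, P \in F -> signed_iso b P P0 s ->
     (translation (1%R : 'Z_v) ^ s)%g \in G) ->
  #|F| <= 2 * #|fixing 0%R G| * #|nbh (emb_graph P0) 0%R|.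
Proof.
move=> h01 htr hiso hG.
have /fin_all_exists[w hw] P : exists w : bool * {perm 'Z_v},
    P \in F -> signed_iso w.1 P P0 w.2 /\ w.2 0%R = 0%R.
  have [PF|_] := boolP (P \in F); last by exists (false, 1%g).
  have [b [s h]] := isomorphic_fixing0 (htr P PF) (hiso P PF).
  by exists (b, s).
pose phi P := ((w P).1, (translation (1%R : 'Z_v) ^ (w P).2)%g).
have phi_inj : {in F &, injective phi}.
  move=> P Q PF QF [eb et].
  have [[hP P0'] [hQ Q0']] := (hw P PF, hw Q QF).
  move: hQ; rewrite -eb -(conj_translation_inj P0' Q0' et).
  exact: signed_iso_inj hP.
rewrite -(card_in_imset phi_inj) -mulnA.
set S := nbh _ _.
apply: leq_trans (leq_mul (leqnn 2) (card_moving_into G 0%R S)).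
rewrite -card_bool -cardsT -cardsX.
apply/subset_leq_card/subsetP => _ /imsetP[P PF ->].
have [hP w0] := hw P PF.
have e : ((translation (1%R : 'Z_v) ^ (w P).2)%g 0 = (w P).2 1)%R.
  by rewrite -{1}w0 permJ translationE add0r.
rewrite !inE /= (hG P _ _ PF hP) /= e.
have /signed_isoP[/(_ (0, 1)%R) + _] := hP.
by rewrite dart_permE /= w0 (h01 P PF : (_, _) \in darts _).
Qed.

End Translations.

(** * The bounds *)

Lemma card_nbh_multipartite (T : finType) (G : sgraph T) (m t : nat) f (x : T) :
  graph_iso G (complete_multipartite m t) f -> #|nbh G x| = (m - 1) * t.
Proof.
move=> /and3P[/injectiveP finj /forallP fsurj /forallP fadj].
have -> : (m - 1) * t = #|setX [set~ (f x).1] [set: 'I_t]|.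
  by rewrite cardsX cardsC1 cardsT !card_ord subn1.
rewrite -(card_imset _ finj); apply: eq_card => y.
have /codomP[z ->] := fsurj y.
rewrite mem_imset // !inE andbT eq_sym.
by have /forallP/(_ z)/eqP <- := fadj x; rewrite /adj inE.
Qed.

Theorem proposition3p4 (m t v : nat) (hm : 2 <= m) (ht : 1 <= t)
    (hv : v = m * t) (F : {set embedding 'Z_v}) (P0 : embedding 'Z_v)
    (hF : forall P : embedding 'Z_v, P \in F -> Z_regular_embedding m t P)
    (h0 : Z_regular_embedding m t P0)
    (hiso : forall P : embedding 'Z_v, P \in F -> isomorphic P P0) :
  let N := #|nbh (emb_graph P0) 0%R| in
  [/\ #|F| <= 2 * #|Aut0 P0| * N,
      2 * #|Aut0 P0| * N <= 4 * N ^ 2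
    & 4 * N ^ 2 = 4 * ((m - 1) * t) ^ 2]
  /\ ((forall P : embedding 'Z_v, P \in F ->
         forall g : 'Z_v, translation g \in Aut_emb_plus P) ->
      [/\ #|F| <= 2 * #|Aut0_plus P0| * N,
          2 * #|Aut0_plus P0| * N <= 2 * N ^ 2
        & 2 * N ^ 2 = 2 * ((m - 1) * t) ^ 2]).
Proof.
have htr P : P \in F -> forall g : 'Z_v, translation g \in Aut_emb P.
  by move=> PF; case: (hF P PF).
have h01 P : P \in F -> adj (emb_graph P) 0%R 1%R.
  by move=> PF; exact: Z_regular_adj01 (hF P PF).
have hN : #|nbh (emb_graph P0) 0%R| = (m - 1) * t.
  by case: h0 => -[f hf] _; exact: card_nbh_multipartite hf.
have N0 : 0 < #|nbh (emb_graph P0) 0%R| by rewrite hN muln_gt0 subn_gt0 hm.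
have bound k A N : A <= k * N -> 2 * A * N <= 2 * k * N ^ 2.
  by move=> hA; rewrite -mulnn mulnA leq_mul // -mulnA leq_mul.
move=> N; split.
  split; [|exact: (bound 2 _ _ (card_Aut_emb_fixing N0))|by rewrite /N hN].
  apply: (card_isomorphic_family (G := Group (Aut_emb_group_set P0))) => //= P b s PF hs.
  have /Aut_embP[c hc] := htr P PF 1%R.
  apply/Aut_embP; exists (b (+) (c (+) b)).
  exact: signed_isoM (signed_isoV hs) (signed_isoM hc hs).
move=> htrp; split; [| |by rewrite /N hN].
  apply: (card_isomorphic_family (G := Group (Aut_emb_plus_group_set P0))) => //= P b s PF hs.
  have := htrp P PF 1%R; rewrite !Aut_emb_plusE => hc.
  (* The sign of [s] enters twice, through [s] and its inverse, and cancels. *)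
  rewrite -(addbb b) -[in X in _ (+) X](addFb b).
  exact: signed_isoM (signed_isoV hs) (signed_isoM hc hs).
by apply: (bound 1); rewrite mul1n; exact: card_Aut_emb_plus_fixing.
Qed.
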